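(* Let $(L,[\cdot,\cdot]_1,[\cdot,\cdot,\cdot]_1,[\cdot,\cdot]_2,[\cdot,\cdot,\cdot]_2)$ be a compatible Lie Yamaguti algebra, let $\Pi_i=(\pi_i,\omega_i)$ with $\pi_i=[\cdot,\cdot]_i$, $\omega_i=[\cdot,\cdot,\cdot]_i$ for $i=1,2$, and let $\partial_{\Pi_i}=[\Pi_i,\cdot]_{\mathrm{LieY}}$. For $n\ge1$ let $\mathfrak{C}_c^n(L,L)$ be the direct sum of $n$ copies of $\mathfrak{C}^{n-1}(L,L)$ (so $\mathfrak{C}_c^1(L,L)=\mathrm{Hom}(L,L)$), and define $\delta_c:\mathfrak{C}_c^n(L,L)\to\mathfrak{C}_c^{n+1}(L,L)$ by $\delta_c(f)=(\partial_{\Pi_1}(f),\partial_{\Pi_2}(f))$ for $f\in\mathrm{Hom}(L,L)$ and, in general, $$\delta_c(F_1,\dots,F_n)=\big(\partial_{\Pi_1}(F_1),\dots,\underbrace{\partial_{\Pi_2}(F_{i-1})+\partial_{\Pi_1}(F_i)}_{i\text{-th place},\ 2\le i\le n},\dots,\partial_{\Pi_2}(F_n)\big).$$ Then $\delta_c\circ\delta_c=0$; that is, $\big(\oplus_{n\ge1}\mathfrak{C}_c^n(L,L),\delta_c\big)$ is a cochain complex.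
   Context: All vector spaces are over a field $\mathbb{K}$ of characteristic $0$. A Lie Yamaguti algebra is a vector space $L$ with a bilinear bracket $[\cdot,\cdot]:\wedge^2L\to L$ and a trilinear bracket $[\cdot,\cdot,\cdot]:\wedge^2L\otimes L\to L$ such that for all $x,y,z,w,t\in L$: (LY1) $[[x,y],z]+[[y,z],x]+[[z,x],y]+[x,y,z]+[y,z,x]+[z,x,y]=0$; (LY2) $[[x,y],z,w]+[[y,z],x,w]+[[z,x],y,w]=0$; (LY3) $[x,y,[z,w]]=[[x,y,z],w]+[z,[x,y,w]]$; (LY4) $[x,y,[z,w,t]]=[[x,y,z],w,t]+[z,[x,y,w],t]+[z,w,[x,y,t]]$. A compatible Lie Yamaguti algebra is a 5-tuple $(L,[\cdot,\cdot]_1,[\cdot,\cdot,\cdot]_1,[\cdot,\cdot]_2,[\cdot,\cdot,\cdot]_2)$ such that $(L,[\cdot,\cdot]_i,[\cdot,\cdot,\cdot]_i)$, $i=1,2$, are Lie Yamaguti algebras and, for all $x,y,z,t,a,b\in L$ (c.p. = the remaining cyclic permutations in $x,y,z$): (CY1) $[[x,y]_1,z]_2+c.p.+[[x,y]_2,z]_1+c.p.=0$; (CY2) $[[x,y]_1,z,t]_2+[[y,z]_1,x,t]_2+[[z,x]_1,y,t]_2+[[x,y]_2,z,t]_1+[[y,z]_2,x,t]_1+[[z,x]_2,y,t]_1=0$; (CY3) $[a,b,[x,y,z]_1]_2+[a,b,[x,y,z]_2]_1=[[a,b,x]_1,y,z]_2+[x,[a,b,y]_1,z]_2+[x,y,[a,b,z]_1]_2+[[a,b,x]_2,y,z]_1+[x,[a,b,y]_2,z]_1+[x,y,[a,b,z]_2]_1$;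 (CY4) $[a,b,[x,y]_1]_2+[a,b,[x,y]_2]_1=[[a,b,x]_1,y]_2+[x,[a,b,y]_1]_2+[[a,b,x]_2,y]_1+[x,[a,b,y]_2]_1$. Graded space: $\mathfrak{C}^0(L,L)=\mathrm{Hom}(L,L)$ and, for $p\ge1$, $\mathfrak{C}^p(L,L)=\mathrm{Hom}((\wedge^2L)^{\otimes p},L)\oplus\mathrm{Hom}((\wedge^2L)^{\otimes p}\otimes L,L)$; $\mathfrak{C}^\star(L,L)=\oplus_{p\ge0}\mathfrak{C}^p(L,L)$, elements of $\mathfrak{C}^p(L,L)$ having degree $p$. $\mathcal{S}_{(i,n-i)}$ is the set of $(i,n-i)$-shuffles, i.e. $\sigma\in S_n$ with $\sigma(1)<\dots<\sigma(i)$ and $\sigma(i+1)<\dots<\sigma(n)$ ($\sigma=\mathrm{id}$ if $i=0$ or $i=n$). For $P=(P_1,P_2)\in\mathfrak{C}^p$, $Q=(Q_1,Q_2)\in\mathfrak{C}^q$, $p,q\ge1$, and $X_i=x_i\wedge y_i\in\wedge^2L$, $x\in L$, put $P\circ Q=((P\circ Q)_1,(P\circ Q)_2)$ with $$(P\circ Q)_1(X_1,\dots,X_{p+q})=\sum_{\sigma\in\mathcal{S}_{(p,q)},\,\sigma(p+q)=p+q}(-1)^{pq}\mathrm{sign}(\sigma)P_2(X_{\sigma(1)},\dots,X_{\sigma(p)},Q_1(X_{\sigma(p+1)},\dots,X_{\sigma(p+q)}))$$ $$+\sum_{k=1}^p(-1)^{(k-1)q}\sum_{\sigma\in\mathcal{S}_{(k-1,q)}}\mathrm{sign}(\sigma)P_1(X_{\sigma(1)},\dots,X_{\sigma(k-1)},x_{q+k}\wedge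 Q_2(X_{\sigma(k)},\dots,X_{\sigma(k+q-1)},y_{k+q}),X_{k+q+1},\dots,X_{p+q})$$ $$+\sum_{k=1}^p(-1)^{(k-1)q}\sum_{\sigma\in\mathcal{S}_{(k-1,q)}}\mathrm{sign}(\sigma)P_1(X_{\sigma(1)},\dots,X_{\sigma(k-1)},Q_2(X_{\sigma(k)},\dots,X_{\sigma(k+q-1)},x_{k+q})\wedge y_{k+q},X_{k+q+1},\dots,X_{p+q}),$$ $$(P\circ Q)_2(X_1,\dots,X_{p+q},x)=\sum_{\sigma\in\mathcal{S}_{(p,q)}}(-1)^{pq}\mathrm{sign}(\sigma)P_2(X_{\sigma(1)},\dots,X_{\sigma(p)},Q_2(X_{\sigma(p+1)},\dots,X_{\sigma(p+q)},x))$$ $$+\sum_{k=1}^p(-1)^{(k-1)q}\sum_{\sigma\in\mathcal{S}_{(k-1,q)}}\mathrm{sign}(\sigma)P_2(X_{\sigma(1)},\dots,X_{\sigma(k-1)},x_{q+k}\wedge Q_2(X_{\sigma(k)},\dots,X_{\sigma(k+q-1)},y_{k+q}),X_{k+q+1},\dots,X_{p+q},x)$$ $$+\sum_{k=1}^p(-1)^{(k-1)q}\sum_{\sigma\in\mathcal{S}_{(k-1,q)}}\mathrm{sign}(\sigma)P_2(X_{\sigma(1)},\dots,X_{\sigma(k-1)},Q_2(X_{\sigma(k)},\dots,X_{\sigma(k+q-1)},x_{k+q})\wedge y_{k+q},X_{k+q+1},\dots,X_{p+q},x).$$ If $p=0$ or $q=0$, the same formulas are used with $f\in\mathfrak{C}^0$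 regarded as having second component $f$ and no (zero) first component: $f\circ Q=(f\circ Q_1,f\circ Q_2)$, and $Q\circ f$ is the sum of all insertions of $f$ into the individual $L$-arguments of $Q$. In particular, for $f\in\mathrm{Hom}(L,L)$, $[\Pi_i,f]_{\mathrm{LieY}}$ has components $(x,y)\mapsto[x,f(y)]_i-[y,f(x)]_i-f([x,y]_i)$ and $(x,y,z)\mapsto[x,y,f(z)]_i+[f(x),y,z]_i-[f(y),x,z]_i-f([x,y,z]_i)$. The bracket $[P,Q]_{\mathrm{LieY}}=P\circ Q-(-1)^{pq}Q\circ P$ makes $\mathfrak{C}^\star(L,L)$ a graded Lie algebra (known). *)

(* Defs.v *)
From HB Require Import structures.
From mathcomp Require Import all_boot all_order all_algebra all_fingroup.
From mathcomp Require Import boolp classical_sets functions.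

Set Implicit Arguments.
Unset Strict Implicit.
Unset Printing Implicit Defensive.

Import GRing.Theory.
Local Open Scope ring_scope.

Section LieYamaguti.
Context {K : fieldType} {L : lmodType K}.

(* A linear map on the exterior square of L is an alternating bilinear map. *)
Definition alternating_bilinear (b : L -> L -> L) : Prop :=
  [/\ forall y, linear (fun x => b x y),
      forall x, linear (b x)
    & forall x, b x x = 0].

Record is_lie_yamaguti (b : L -> L -> L) (t : L -> L -> L -> L) : Prop := {
  ly_binary : alternating_bilinear b;
  ly_ternary_alternating : forall z, alternating_bilinear (fun x y => t x y z);
  ly_ternary_linear : forall x y, linear (t x y);
  ly_axiom1 : forall x y z,
    b (b x y) z + b (b y z) x + b (b z x) y + t x y z + t y z x + t z x y = 0;
  ly_axiom2 : forall x y z w,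
    t (b x y) z w + t (b y z) x w + t (b z x) y w = 0;
  ly_axiom3 : forall x y z w,
    t x y (b z w) = b (t x y z) w + b z (t x y w);
  ly_axiom4 : forall x y z w u,
    t x y (t z w u) = t (t x y z) w u + t z (t x y w) u + t z w (t x y u)
}.

Record is_compatible_lie_yamaguti
    (b1 : L -> L -> L) (t1 : L -> L -> L -> L)
    (b2 : L -> L -> L) (t2 : L -> L -> L -> L) : Prop := {
  cly_left : is_lie_yamaguti b1 t1;
  cly_right : is_lie_yamaguti b2 t2;
  cly_axiom1 : forall x y z,
    b2 (b1 x y) z + b2 (b1 y z) x + b2 (b1 z x) y
    + (b1 (b2 x y) z + b1 (b2 y z) x + b1 (b2 z x) y) = 0;
  cly_axiom2 : forall x y z u,
    t2 (b1 x y) z u + t2 (b1 y z) x u + t2 (b1 z x) y u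
    + t1 (b2 x y) z u + t1 (b2 y z) x u + t1 (b2 z x) y u = 0;
  cly_axiom3 : forall a b x y z,
    t2 a b (t1 x y z) + t1 a b (t2 x y z) =
      t2 (t1 a b x) y z + t2 x (t1 a b y) z + t2 x y (t1 a b z)
    + t1 (t2 a b x) y z + t1 x (t2 a b y) z + t1 x y (t2 a b z);
  cly_axiom4 : forall a b x y,
    t2 a b (b1 x y) + t1 a b (b2 x y) =
      b2 (t1 a b x) y + b2 x (t1 a b y) + b1 (t2 a b x) y + b1 x (t2 a b y)
}.

(* [args p] is the type of (X_1, .., X_p), where X_i = x_i /\ y_i is given by
   the pair (x_i, y_i).  Indices start at 0 throughout. *)
Definition args (p : nat) : Type := {ffun 'I_p -> L * L}.

Definition set_arg p (X : args p) (k : 'I_p) (xy : L * L) : args p :=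
  [ffun i => if i == k then xy else X i].

(* By the universal properties of the exterior square and the tensor product,
   these are the linear maps from the p-th tensor power of the exterior square
   of L to L. *)
Definition wedge_multilinear p (P : args p -> L) : Prop :=
  forall (X : args p) (k : 'I_p),
    alternating_bilinear (fun x y => P (set_arg X k (x, y))).

(* The ambient space of pairs (P_1, P_2) of arbitrary maps. *)
Definition precochain (p : nat) : lmodType K :=
  ((args p -> L) * (args p -> L -> L))%type.

(* The subspace C^p(L,L).  For p = 0 the first component vanishes and the
   second one, having no argument besides its last one, is an element of
   Hom(L,L). *)
Definition cochain (p : nat) : set (precochain p) := fun P =>
  [/\ p = 0%N -> P.1 = 0,
      wedge_multilinear P.1,
      forall x, wedge_multilinear (fun X => P.2 X x)
    & forall X, linear (P.2 X)].

Definition is_shuffle (i j : nat) (s : 'S_(i + j)) : bool :=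
  [forall a : 'I_(i + j), forall b : 'I_(i + j),
     (a < b)%N && ((b < i)%N || (i <= a)%N) ==> (s a < s b)%N].

Definition fixes_last n (s : 'S_n) : bool :=
  [forall a : 'I_n, (a.+1 == n) ==> (s a == a)].

(* Access by natural numbers, which avoids casts between ordinal types.  The
   default values are never reached in the formulas below. *)
Definition nth_arg n (X : args n) (i : nat) : L * L := oapp X 0 (insub i).
Definition perm_nat n (s : 'S_n) (i : nat) : nat :=
  oapp (fun j : 'I_n => val (s j)) i (insub i).

(* (X_s(0), .., X_s(k-1), xy, X_(k+q+1), .., X_(p+q-1)) *)
Definition plug p q (X : args (p + q)) (k : 'I_p) (s : 'S_(k + q))
    (xy : L * L) : args p :=
  [ffun i : 'I_p =>
     if (i < k)%N then nth_arg X (perm_nat s i)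
     else if i == k then xy
     else nth_arg X (i + q)].

(* (X_s(k), .., X_s(k+q-1)) *)
Definition inner_args p q (X : args (p + q)) (k : 'I_p) (s : 'S_(k + q)) :
    args q :=
  [ffun i : 'I_q => nth_arg X (perm_nat s (k + i))].

(* The two sums over k in P o Q; [F] is P_1, or P_2 with its last argument
   fixed.  The index k is one less than in the usual 1-based formula, whence
   the sign (-1)^(kq) and the distinguished pair of index q + k. *)
Definition insertions p q (F : args p -> L) (Q : precochain q)
    (X : args (p + q)) : L :=
    \sum_(k < p) \sum_(s : 'S_(k + q) | is_shuffle s)
      ((-1) ^+ (k * q) * (-1) ^+ s : K) *:
        F (plug X s ((nth_arg X (q + k)).1,
                     Q.2 (inner_args X s) (nth_arg X (q + k)).2))
  + \sum_(k < p) \sum_(s : 'S_(k + q) | is_shuffle s)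
      ((-1) ^+ (k * q) * (-1) ^+ s : K) *:
        F (plug X s (Q.2 (inner_args X s) (nth_arg X (q + k)).1,
                     (nth_arg X (q + k)).2)).

Definition circ p q (P : precochain p) (Q : precochain q) :
    precochain (p + q) :=
  (fun X : args (p + q) =>
       \sum_(s : 'S_(p + q) | is_shuffle s && fixes_last s)
         ((-1) ^+ (p * q) * (-1) ^+ s : K) *:
           P.2 [ffun i : 'I_p => X (s (lshift q i))]
               (Q.1 [ffun i : 'I_q => X (s (rshift p i))])
     + insertions P.1 Q X,
   fun (X : args (p + q)) (x : L) =>
       \sum_(s : 'S_(p + q) | is_shuffle s)
         ((-1) ^+ (p * q) * (-1) ^+ s : K) *:
           P.2 [ffun i : 'I_p => X (s (lshift q i))]
               (Q.2 [ffun i : 'I_q => X (s (rshift p i))] x)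
     + insertions (fun Y => P.2 Y x) Q X).

(* Transport of degree along m = n. *)
Definition recast m n (e : m = n) (P : precochain m) : precochain n :=
  (fun X : args n => P.1 [ffun i => X (cast_ord e i)],
   fun (X : args n) (x : L) => P.2 [ffun i => X (cast_ord e i)] x).

Definition lieY_bracket p q (P : precochain p) (Q : precochain q) :
    precochain (p + q) :=
  circ P Q - ((-1) ^+ (p * q) : K) *: recast (addnC q p) (circ Q P).

Definition structure_cochain (b : L -> L -> L) (t : L -> L -> L -> L) :
    precochain 1 :=
  (fun X : args 1 => b (X ord0).1 (X ord0).2,
   fun (X : args 1) (z : L) => t (X ord0).1 (X ord0).2 z).

Definition partial (b : L -> L -> L) (t : L -> L -> L -> L) p
    (F : precochain p) : precochain p.+1 :=
  lieY_bracket (structure_cochain b t) F.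

(* [compat_precochain m] contains C_c^(m+1)(L,L), the sum of m+1 copies of
   C^m(L,L). *)
Definition compat_precochain (m : nat) : lmodType K :=
  {ffun 'I_m.+1 -> precochain m}.

Definition compat_cochain (m : nat) : set (compat_precochain m) :=
  fun F => forall i, cochain (F i).

Definition delta_c (b1 : L -> L -> L) (t1 : L -> L -> L -> L)
    (b2 : L -> L -> L) (t2 : L -> L -> L -> L) (m : nat)
    (F : compat_precochain m) : compat_precochain m.+1 :=
  [ffun i : 'I_m.+2 =>
     if i == ord0 then partial b1 t1 (F ord0)
     else if i == ord_max then partial b2 t2 (F ord_max)
     else partial b2 t2 (F (inord i.-1)) + partial b1 t1 (F (inord i))].

(* The subspaces C n of V n, with d, form a cochain complex. *)
Definition is_cochain_complex (V : nat -> lmodType K)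
    (C : forall n, set (V n)) (d : forall n, V n -> V n.+1) : Prop :=
  forall n,
  [/\ C n 0 /\ (forall (a : K) u v, C n u -> C n v -> C n (a *: u + v)),
      forall u, C n u -> C n.+1 (d n u),
      forall (a : K) u v, C n u -> C n v -> d n (a *: u + v) = a *: d n u + d n v
    & forall u, C n u -> d n.+1 (d n u) = 0].

End LieYamaguti.

(* Main.v *)
Require Import Defs.
From HB Require Import structures.
From mathcomp Require Import all_boot all_order all_algebra all_fingroup.
From mathcomp Require Import boolp classical_sets functions.

Set Implicit Arguments.
Unset Strict Implicit.
Unset Printing Implicit Defensive.

Import GRing.Theory.
Local Open Scope ring_scope.

(** Write g for the pairs x /\ y.  A structure Pi = (b, t) gives a map
    D : g -> gl(L), D(X) = t(X, -), and (LY3) and (LY4) say exactly that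
    D(X).Pi = 0 for all X, where gl(L) acts naturally on pairs of multilinear
    maps.  Up to the sign (-1)^p, [Pi, -] on C^p is the operator E determined by
    the Cartan-type recursion i_X E + E i_X = D(X), where i_X plugs X into the
    first place, starting from E f = - f.Pi on C^0 = gl(L).  Induction on the
    degree gives first [D(X), E] = 0 and then E E = 0.  Compatibility means that
    Pi_1 + Pi_2 again satisfies D(X).Pi = 0, so polarising E E = 0 shows that
    E_1 and E_2 anticommute, whence delta_c delta_c = 0. *)

(** * A reflexive decision procedure for abelian groups *)

Inductive abel_expr :=
  | AbelVar of nat | AbelZero
  | AbelAdd of abel_expr & abel_expr | AbelOpp of abel_expr.

Fixpoint abel_eval (V : zmodType) (env : seq V) (e : abel_expr) : V :=
  match e with
  | AbelVar n => env`_n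
  | AbelZero => 0
  | AbelAdd e1 e2 => abel_eval env e1 + abel_eval env e2
  | AbelOpp e1 => - abel_eval env e1
  end.

Fixpoint abel_coef (e : abel_expr) (i : nat) : int :=
  match e with
  | AbelVar n => (i == n)%:Z
  | AbelZero => 0
  | AbelAdd e1 e2 => abel_coef e1 i + abel_coef e2 i
  | AbelOpp e1 => - abel_coef e1 i
  end.

(** Normal form as an integer combination of atoms. A variable beyond the list takes the default
    value 0, so the sum may stop at [size env]. *)
Lemma abel_evalE (V : zmodType) (env : seq V) e :
  abel_eval env e = \sum_(i < size env) env`_i *~ abel_coef e i.
Proof.
elim: e => [n||e1 IH1 e2 IH2|e IH] /=.
- have [lt_n|le_n] := ltnP n (size env).
    rewrite (bigD1 (Ordinal lt_n)) //= eqxx mulr1z big1 ?addr0 // => i.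
    by rewrite -val_eqE /= => /negPf ->; rewrite mulr0z.
  rewrite nth_default // big1 // => i _.
  by rewrite ltn_eqF ?mulr0z // (leq_trans (ltn_ord i)).
- by rewrite big1 // => i _; rewrite mulr0z.
- by rewrite IH1 IH2 -big_split; apply: eq_bigr => i _; rewrite mulrzDr.
- by rewrite IH -sumrN; apply: eq_bigr => i _; rewrite mulrNz.
Qed.

Lemma abel_eq (V : zmodType) (env : seq V) e1 e2 :
  all (fun i => abel_coef e1 i == abel_coef e2 i) (iota 0 (size env)) ->
  abel_eval env e1 = abel_eval env e2.
Proof.
move=> /allP eq_coef; rewrite !abel_evalE; apply: eq_bigr => i _.
by rewrite (eqP (eq_coef (val i) _)) // mem_iota add0n ltn_ord.
Qed.

(** Atoms are compared by [unify], up to conversion, so differently folded forms of one term count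
    once; the inner [match goal] runs that test while the index is computed. *)
Ltac abel_index env x :=
  match env with
  | ?y :: _ => let _ := match goal with _ => unify x y end in constr:(0%N)
  | _ :: ?env' => let n := abel_index env' x in constr:(n.+1)
  end.

Ltac abel_atoms env e :=
  match e with
  | (?x + ?y)%R => let env' := abel_atoms env x in abel_atoms env' y
  | (- ?x)%R => abel_atoms env x
  | 0%R => env
  | _ => match env with
         | _ => let n := abel_index env e in env
         | _ => constr:(e :: env)
         end
  end.

Ltac abel_reify env e :=
  match e with
  | (?x + ?y)%R =>
      let x' := abel_reify env x in
      let y' := abel_reify env y in constr:(AbelAdd x' y')
  | (- ?x)%R => let x' := abel_reify env x in constr:(AbelOpp x')
  | 0%R => constr:(AbelZero)
  | _ => let n := abel_index env e in constr:(AbelVar n)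
  end.

(* Decides identities that hold in every abelian group. *)
Ltac abel :=
  match goal with |- @eq ?T ?x ?y =>
    let env0 := abel_atoms (@nil T) x in
    let env := abel_atoms env0 y in
    let e1 := abel_reify env x in
    let e2 := abel_reify env y in
    apply: (@abel_eq _ env e1 e2); vm_compute; reflexivity
  end.

(** * The Leibniz-type coboundary *)

Section LinearPredicate.
Context {K : fieldType} {U V : lmodType K} (f : U -> V) (lin_f : linear f).

Let g : {linear U -> V} := HB.pack f (GRing.isLinear.Build K U V *:%R f lin_f).

Lemma linear_add : {morph f : x y / x + y}. Proof. exact: (raddfD g). Qed.
Lemma linear_sub : {morph f : x y / x - y}. Proof. exact: (raddfB g). Qed.
Lemma linear_opp : {morph f : x / - x}. Proof. exact: (raddfN g). Qed.
Lemma linear_zero : f 0 = 0. Proof. exact: (raddf0 g). Qed.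
Lemma linear_scale a : {morph f : x / a *: x}.
Proof. exact: (linearZ_LR g). Qed.

End LinearPredicate.

Section Algebra.
Context {K : fieldType} {L : lmodType K}.
Implicit Types (phi psi : L -> L) (X : L * L) (a : K).

Local Notation pre := (@precochain K L).

(** * Lists of arguments and the action of gl(L) on pairs of maps *)

Lemma args0_unique (X Y : @args K L 0) : X = Y.
Proof. by apply/ffunP; case. Qed.

Definition no_args : @args K L 0 := [ffun=> 0].

Definition args_cons p X (Y : @args K L p) : @args K L p.+1 :=
  [ffun i => oapp Y X (unlift ord0 i)].

Definition args_del p (X : @args K L p.+1) (j : 'I_p.+1) : @args K L p :=
  [ffun i => X (lift j i)].

Lemma args_cons0 p X (Y : args p) : args_cons X Y ord0 = X.
Proof. by rewrite ffunE unlift_none. Qed.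

Lemma args_consS p X (Y : args p) i : args_cons X Y (lift ord0 i) = Y i.
Proof. by rewrite ffunE liftK. Qed.

Lemma args_del0 p X (Y : args p) : args_del (args_cons X Y) ord0 = Y.
Proof. by apply/ffunP => i; rewrite ffunE args_consS. Qed.

Lemma args_consK p (X : @args K L p.+1) :
  args_cons (X ord0) (args_del X ord0) = X.
Proof.
apply/ffunP => i; case: (unliftP ord0 i) => [j|] ->.
  by rewrite args_consS ffunE.
by rewrite args_cons0.
Qed.

Lemma args_delS p X (Y : @args K L p.+1) j :
  args_del (args_cons X Y) (lift ord0 j) = args_cons X (args_del Y j).
Proof.
apply/ffunP => i; case: (unliftP ord0 i) => [k|] ->.
  rewrite args_consS !ffunE.
  have -> : lift (lift ord0 j) (lift ord0 k) = lift ord0 (lift j k).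
    by apply: val_inj => /=; rewrite /bump /= !add1n ltnS addnS.
  by rewrite liftK.
rewrite args_cons0 !ffunE.
have -> : lift (lift ord0 j) ord0 = ord0 by apply: val_inj.
by rewrite unlift_none.
Qed.

Lemma set_arg_cons0 p X (Y : args p) xy :
  set_arg (args_cons X Y) ord0 xy = args_cons xy Y.
Proof.
apply/ffunP => i; rewrite ffunE; case: (unliftP ord0 i) => [k|] ->.
  by rewrite !args_consS.
by rewrite eqxx !args_cons0.
Qed.

Lemma set_arg_consS p X (Y : args p) k xy :
  set_arg (args_cons X Y) (lift ord0 k) xy = args_cons X (set_arg Y k xy).
Proof.
apply/ffunP => i; rewrite ffunE; case: (unliftP ord0 i) => [j|] ->.
  by rewrite !args_consS (inj_eq lift_inj) ffunE.
by rewrite (negPf (neq_lift _ _)) !args_cons0.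
Qed.

(* The derivation of the tensor algebra extending phi, restricted to the
   arguments of index at least m. *)
Definition derive_args (V : zmodType) p (m : nat) phi (F : @args K L p -> V)
    (Y : args p) : V :=
  \sum_(k < p | (m <= k)%N)
    (F (set_arg Y k (phi (Y k).1, (Y k).2)) +
     F (set_arg Y k ((Y k).1, phi (Y k).2))).

Lemma derive_args_cons0 (V : zmodType) p phi (F : args p.+1 -> V) X Y :
  derive_args 0 phi F (args_cons X Y) =
    F (args_cons (phi X.1, X.2) Y) + F (args_cons (X.1, phi X.2) Y)
    + derive_args 0 phi (fun Z => F (args_cons X Z)) Y.
Proof.
rewrite /derive_args big_ord_recl args_cons0 !set_arg_cons0; congr (_ + _).
by apply: eq_bigr => k _; rewrite args_consS !set_arg_consS.
Qed.

Lemma derive_args_consS (V : zmodType) p m phi (F : args p.+1 -> V) X Y :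
  derive_args m.+1 phi F (args_cons X Y) =
    derive_args m phi (fun Z => F (args_cons X Z)) Y.
Proof.
rewrite /derive_args big_mkcond big_ord_recl /= add0r.
rewrite [RHS]big_mkcond; apply: eq_bigr => k _ /=.
by rewrite args_consS !set_arg_consS.
Qed.

Lemma derive_args_nil (V : zmodType) m phi (F : args 0 -> V) Y :
  derive_args m phi F Y = 0.
Proof. by rewrite /derive_args big_ord0. Qed.

(* The natural action of phi on Hom(T, L) (+) Hom(T (x) L, L). *)
Definition lie_act phi p (F : pre p) : pre p :=
  (fun Y => phi (F.1 Y) - derive_args 0 phi F.1 Y,
   fun Y z => phi (F.2 Y z) - F.2 Y (phi z) -
              derive_args 0 phi (fun Y' => F.2 Y' z) Y).

(** The interior product i_X. *)
Definition contract p X (F : pre p.+1) : pre p :=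
  (fun Y => F.1 (args_cons X Y), fun Y => F.2 (args_cons X Y)).

Arguments contract {p} X F.

Lemma precochain_eq p (F G : pre p) :
  (forall Y, F.1 Y = G.1 Y) -> (forall Y z, F.2 Y z = G.2 Y z) -> F = G.
Proof.
case: F G => [F1 F2] [G1 G2] /= e1 e2; congr pair; first exact/funext.
by apply: funext => Y; apply: funext.
Qed.

(** A nonempty list is a head consed to a tail, so the i_X jointly determine a pair of positive
    degree. This opens many of the inductive steps below. *)
Lemma contract_inj p (F G : pre p.+1) :
  (forall X, contract X F = contract X G) -> F = G.
Proof.
move=> eFG; apply: precochain_eq => [Y|Y z]; rewrite -(args_consK Y).
  exact: (congr1 (fun H : pre p => H.1 (args_del Y ord0)) (eFG (Y ord0))).
exact: (congr1 (fun H : pre p => H.2 (args_del Y ord0) z) (eFG (Y ord0))).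
Qed.

Lemma contract_linear p X : linear (contract (p:=p) X).
Proof. by []. Qed.

Lemma fstD p (F G : pre p) Y : (F + G).1 Y = F.1 Y + G.1 Y. Proof. by []. Qed.
Lemma fstN p (F : pre p) Y : (- F).1 Y = - F.1 Y. Proof. by []. Qed.
Lemma fstZ p a (F : pre p) Y : (a *: F).1 Y = a *: F.1 Y. Proof. by []. Qed.
Lemma sndD p (F G : pre p) Y z : (F + G).2 Y z = F.2 Y z + G.2 Y z.
Proof. by []. Qed.
Lemma sndN p (F : pre p) Y z : (- F).2 Y z = - F.2 Y z. Proof. by []. Qed.
Lemma sndZ p a (F : pre p) Y z : (a *: F).2 Y z = a *: F.2 Y z.
Proof. by []. Qed.

Definition precochainE := (fstD, fstN, fstZ, sndD, sndN, sndZ).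

(** [G] at phi.(x /\ y) = phi(x) /\ y + x /\ phi(y), without forming sums of wedges. *)
Definition derive_slot (V : zmodType) phi (G : L * L -> V) X : V :=
  G (phi X.1, X.2) + G (X.1, phi X.2).

(** The commutation rule [phi, i_X] = i_(phi.X): the correction is the contribution of the first
    slot to [derive_args]. *)
Lemma contract_act p phi X (F : pre p.+1) :
  contract X (lie_act phi F) =
    lie_act phi (contract X F) - derive_slot phi (contract^~ F) X.
Proof.
apply: precochain_eq => [Y|Y z] /=; rewrite derive_args_cons0.
  by rewrite opprD addrA addrAC.
by rewrite opprD addrA addrAC.
Qed.

Lemma lie_act_linear p phi : linear phi -> linear (@lie_act phi p).
Proof.
move=> lphi a F G.
have derive_lin (H H' : @args K L p -> L) Y :
    derive_args 0 phi (fun Z => a *: H Z + H' Z) Y =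
    a *: derive_args 0 phi H Y + derive_args 0 phi H' Y.
  rewrite /derive_args scaler_sumr -big_split; apply: eq_bigr => k _ /=.
  by rewrite scalerDr addrACA.
apply: precochain_eq => [Y|Y z].
  rewrite !precochainE {1}/lie_act /= (derive_lin F.1 G.1).
  by rewrite lphi scalerBr; abel.
rewrite !precochainE {1}/lie_act /= (derive_lin (F.2^~ z) (G.2^~ z)).
rewrite -[(_ + _) Y (phi z)]/(a *: F.2 Y (phi z) + G.2 Y (phi z)).
by rewrite lphi !scalerBr; abel.
Qed.

Definition alternating (V : lmodType K) (G : L * L -> V) : Prop :=
  [/\ forall y, linear (fun x => G (x, y)),
      forall x, linear (fun y => G (x, y))
    & forall x, G (x, x) = 0].

(* In degree 0 the first component is left unconstrained: contracting a cochain
   of degree 1 leaves a value there, which [coboundary] ignores. *)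
Fixpoint multilinear p : pre p -> Prop :=
  match p with
  | 0 => fun F => linear (F.2 no_args)
  | p'.+1 => fun F => alternating (contract^~ F)
                      /\ forall X, multilinear (contract X F)
  end.

Lemma multilinear_linear p (F : pre p) Y : multilinear F -> linear (F.2 Y).
Proof.
elim: p F Y => [|p IHp] F Y; first by rewrite (args0_unique Y no_args).
move=> [_ mF]; rewrite -(args_consK Y); exact: IHp (mF (Y ord0)).
Qed.

Lemma multilinearP p a (F G : pre p) :
  multilinear F -> multilinear G -> multilinear (a *: F + G).
Proof.
elim: p F G => [|p IHp] F G /=.
  move=> lF lG c x y; rewrite [LHS](_ : _ = a *: F.2 no_args (c *: x + y)
     + G.2 no_args (c *: x + y)) //.
  by rewrite lF lG scalerDr addrACA !scalerA mulrC -scalerA -scalerDr.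
move=> [[lF rF aF] mF] [[lG rG aG] mG].
split; last by move=> X; apply: (IHp (contract X F) (contract X G)).
split=> [y c x x' | x c y y' | x].
- rewrite !contract_linear lF lG scalerDr addrACA !scalerA mulrC -scalerA.
  by rewrite -scalerDr.
- rewrite !contract_linear rF rG scalerDr addrACA !scalerA mulrC -scalerA.
  by rewrite -scalerDr.
- by rewrite contract_linear aF aG scaler0 addr0.
Qed.

(** Apart from the outer term, [phi] occurs once in each term, inside one argument of [F]; linearity
    of [F] there becomes linearity in [phi]. *)
Lemma lie_act_linear_l p (F : pre p) a phi psi : multilinear F ->
  lie_act (fun x => a *: phi x + psi x) F = a *: lie_act phi F + lie_act psi F.
Proof.
elim: p F => [|p IHp] F mF.
  apply: precochain_eq => [Y|Y z]; rewrite !precochainE /lie_act /=.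
    by rewrite !derive_args_nil !subr0.
  rewrite !derive_args_nil !subr0 (multilinear_linear Y mF).
  by rewrite scalerBr opprD addrACA.
have [[lF rF _] mF'] := mF.
apply: contract_inj => X.
rewrite contract_linear !contract_act IHp; last exact: mF'.
by rewrite /derive_slot /= lF rF scalerBr scalerDr; abel.
Qed.

(** gl(L) acts by a representation. After contraction, the terms in which phi or psi acts on X and
    the other one from outside are symmetric and cancel; the rest combine, by linearity in the first
    slot, into the slot term of the commutator. *)
Lemma lie_act_bracket p (F : pre p) phi psi :
  linear phi -> linear psi -> multilinear F ->
  lie_act (fun x => phi (psi x) - psi (phi x)) F =
    lie_act phi (lie_act psi F) - lie_act psi (lie_act phi F).
Proof.
move=> lphi lpsi; elim: p F => [|p IHp] F mF.
  have lF := multilinear_linear _ mF.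
  apply: precochain_eq => [Y|Y z]; rewrite !precochainE /lie_act /=.
    by rewrite !derive_args_nil !subr0.
  rewrite !derive_args_nil !subr0.
  rewrite (linear_sub lphi) (linear_sub lpsi) (linear_sub (lF Y)).
  abel.
have [[lF rF _] mF'] := mF.
apply: contract_inj => X.
rewrite [RHS](linear_sub (contract_linear X)) !contract_act /derive_slot /=.
rewrite !contract_act IHp; last exact: mF'.
rewrite /derive_slot /=.
rewrite (linear_sub (lF _)) (linear_sub (rF _)).
rewrite !(linear_sub (lie_act_linear lphi)) !(linear_sub (lie_act_linear lpsi)).
rewrite !(linear_add (lie_act_linear lphi)) !(linear_add (lie_act_linear lpsi)).
abel.
Qed.

Lemma lie_act_add_l p (F : pre p) phi psi : multilinear F ->
  lie_act (fun x => phi x + psi x) F = lie_act phi F + lie_act psi F.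
Proof.
move=> mF; have := lie_act_linear_l 1 phi psi mF; rewrite scale1r => <-.
by congr (lie_act _ F); apply: funext => x; rewrite scale1r.
Qed.

(** * The coboundary and the vanishing of its square *)

Definition glue p (G : L * L -> pre p) : pre p.+1 :=
  (fun Y : @args K L p.+1 => (G (Y ord0)).1 (args_del Y ord0),
   fun Y : @args K L p.+1 => (G (Y ord0)).2 (args_del Y ord0)).

Lemma contract_glue p X (G : L * L -> pre p) : contract X (glue G) = G X.
Proof. by apply: precochain_eq => *; rewrite /= args_cons0 args_del0. Qed.

Definition adj (Pi : pre 1) X : L -> L := Pi.2 (args_cons X no_args).

(* The Cartan-type recursion; see [contract_coboundary]. *)
Fixpoint coboundary (Pi : pre 1) p : pre p -> pre p.+1 :=
  match p with
  | 0 => fun F => - lie_act (F.2 no_args) Pi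
  | p'.+1 => fun F =>
      glue (fun X => lie_act (adj Pi X) F - coboundary Pi (contract X F))
  end.

Lemma coboundary0E Pi (F : pre 0) :
  coboundary Pi F = - lie_act (F.2 no_args) Pi.
Proof. by []. Qed.

Lemma lie_act0E phi (F : pre 0) :
  (lie_act phi F).2 no_args =
    fun z => phi (F.2 no_args z) - F.2 no_args (phi z).
Proof. by apply: funext => z; rewrite /lie_act /= derive_args_nil subr0. Qed.

Lemma contract_coboundary Pi p X (F : pre p.+1) :
  contract X (coboundary Pi F) =
    lie_act (adj Pi X) F - coboundary Pi (contract X F).
Proof. by rewrite /= contract_glue. Qed.

(** Reads the second component of phi.Pi as [phi, D(X)] - D(phi.X), which ties the action on [Pi] to
    commutators in gl(L). *)
Lemma contract_act_adj phi (Pi : pre 1) X z :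
  (contract X (lie_act phi Pi)).2 no_args z =
    phi (adj Pi X z) - adj Pi X (phi z)
    - (adj Pi (phi X.1, X.2) z + adj Pi (X.1, phi X.2) z).
Proof.
rewrite contract_act /derive_slot !precochainE {1}/lie_act /=.
by rewrite derive_args_nil subr0.
Qed.

Arguments coboundary Pi {p} F : simpl never.

Section Coboundary.
Context (Pi : pre 1) (multi_Pi : multilinear Pi).

Lemma adj_linear X : linear (adj Pi X).
Proof. exact: multilinear_linear. Qed.

Lemma coboundary_linear p : linear (coboundary Pi (p := p)).
Proof.
elim: p => [|p IHp] a F G.
  rewrite !coboundary0E [(a *: F + G).2 _](_ : _ = fun x =>
    a *: F.2 no_args x + G.2 no_args x) //.
  by rewrite lie_act_linear_l // opprD scalerN.
apply: contract_inj => X.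
rewrite contract_linear !contract_coboundary contract_linear IHp.
rewrite (lie_act_linear (adj_linear X)) scalerBr; abel.
Qed.

Hypothesis act_adj_Pi : forall X, lie_act (adj Pi X) Pi = 0.

(** The Leibniz identity D(D(X).Y) = [D(X), D(Y)], which is the second component of D(X).Pi = 0. *)
Lemma adj_slot X Y :
  (fun z => adj Pi (adj Pi X Y.1, Y.2) z + adj Pi (Y.1, adj Pi X Y.2) z) =
  (fun z => adj Pi X (adj Pi Y z) - adj Pi Y (adj Pi X z)).
Proof.
apply: funext => z; have := contract_act_adj (adj Pi X) Pi Y z.
by rewrite act_adj_Pi => /esym /eqP; rewrite subr_eq0 => /eqP.
Qed.

(** In degree 0, D(X).(f.Pi) = [D(X), f].Pi + f.(D(X).Pi), and the last term vanishes. In higher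
    degree, contraction with Y and the induction hypothesis for i_Y F reduce the claim to [adj_slot]
    acting on [F]. *)
Lemma act_coboundary p X (F : pre p) : multilinear F ->
  lie_act (adj Pi X) (coboundary Pi F) = coboundary Pi (lie_act (adj Pi X) F).
Proof.
have lact q Y := lie_act_linear (p := q) (adj_linear Y).
elim: p F => [|p IHp] F mF.
  rewrite !coboundary0E (linear_opp (@lact _ X)) lie_act0E.
  rewrite lie_act_bracket //; last exact: adj_linear.
  by rewrite act_adj_Pi (linear_zero (lie_act_linear mF)) subr0.
have mF' := proj2 mF.
apply: contract_inj => Y.
rewrite contract_act /derive_slot !contract_coboundary contract_act.
rewrite (linear_sub (@lact _ X)) IHp; last exact: mF'.
rewrite !(linear_sub (@coboundary_linear _)).
rewrite (linear_add (@coboundary_linear _)).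
have := lie_act_bracket (adj_linear X) (adj_linear Y) mF.
rewrite -adj_slot lie_act_add_l // => /eqP; rewrite eq_sym subr_eq => /eqP ->.
abel.
Qed.

(** In positive degree, i_X E E F = D(X).(E F) - E(D(X).F) + E E i_X F: the first two terms cancel
    by [act_coboundary], the last vanishes by induction. *)
Lemma coboundary_square p (F : pre p) : multilinear F ->
  coboundary Pi (coboundary Pi F) = 0.
Proof.
have lact q Y := lie_act_linear (p := q) (adj_linear Y).
elim: p F => [|p IHp] F mF; apply: contract_inj => X.
  rewrite contract_coboundary act_coboundary // !coboundary0E lie_act0E.
  (* For f in degree 0, the second component of i_X E f is [D(X), f] + D(f.X), and both summands of
     D(f.X) annihilate [Pi]. *)
  rewrite [(contract X _).2 _](_ : _ = fun z =>
      (adj Pi X (F.2 no_args z) - F.2 no_args (adj Pi X z))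
      + (adj Pi (F.2 no_args X.1, X.2) z + adj Pi (X.1, F.2 no_args X.2) z)).
    by rewrite !lie_act_add_l // !act_adj_Pi !addr0 subrr.
  apply: funext => z; have := contract_act_adj (F.2 no_args) Pi X z.
  set G := lie_act _ Pi; rewrite -[(contract X (- G)).2 _ z]/
    (- ((contract X G).2 no_args z)) => ->; abel.
rewrite contract_coboundary contract_coboundary.
rewrite (linear_sub (@coboundary_linear _)) IHp; last exact: (proj2 mF).
by rewrite act_coboundary // subr0 subrr.
Qed.

End Coboundary.

(** Additivity in [Pi], which lets E E = 0 be polarised. *)
Lemma coboundary_add_l Pi1 Pi2 p (F : pre p) :
  multilinear Pi1 -> multilinear Pi2 -> multilinear F ->
  coboundary (Pi1 + Pi2) F = coboundary Pi1 F + coboundary Pi2 F.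
Proof.
move=> m1 m2; elim: p F => [|p IHp] F mF.
  by rewrite !coboundary0E (linear_add (lie_act_linear mF)) opprD.
apply: contract_inj => X.
rewrite [RHS](linear_add (@contract_linear p.+1 X)) !contract_coboundary.
rewrite IHp; last exact: (proj2 mF).
rewrite [adj _ X](_ : _ = fun z => adj Pi1 X z + adj Pi2 X z) //.
rewrite lie_act_add_l //.
abel.
Qed.

(** * Stability of multilinear pairs *)

Lemma multilinear_sub p (F G : pre p) :
  multilinear F -> multilinear G -> multilinear (F - G).
Proof. by move=> mF mG; rewrite addrC -scaleN1r; apply: multilinearP. Qed.

Lemma multilinear_opp p (F : pre p) : multilinear F -> multilinear (- F).
Proof.
by move=> mF; rewrite -sub0r -(subrr F); do 2!apply: multilinear_sub => //.
Qed.

Lemma multilinear_add p (F G : pre p) :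
  multilinear F -> multilinear G -> multilinear (F + G).
Proof.
by move=> mF mG; rewrite -[G]opprK; apply/multilinear_sub/multilinear_opp.
Qed.

Lemma alternating_skew (V : lmodType K) (G : L * L -> V) x y :
  alternating G -> G (x, y) + G (y, x) = 0.
Proof.
move=> [lG rG aG]; have := aG (x + y).
by rewrite (linear_add (lG _)) !(linear_add (rG _)) !aG add0r addr0.
Qed.

(** Alternation survives because the slot term at x /\ x is F(phi x /\ x, ...) + F(x /\ phi x, ...),
    zero by skew-symmetry. *)
Lemma multilinear_act p phi (F : pre p) :
  linear phi -> multilinear F -> multilinear (lie_act phi F).
Proof.
move=> lphi; elim: p F => [|p IHp] F mF.
  move=> a x y; rewrite /= !derive_args_nil !subr0.
  have lF : linear (F.2 no_args) by [].
  by rewrite lphi !lF lphi scalerBr; abel.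
have lact := lie_act_linear (p := p) lphi.
have [altF mF'] := mF; have [lF rF aF] := altF.
split=> [|X]; last first.
  rewrite contract_act; apply: multilinear_sub; first exact/IHp/mF'.
  by apply: multilinear_add; apply: mF'.
split=> [y a x x' | x a y y' | x]; rewrite !contract_act /derive_slot /=.
- by rewrite lphi !lF lact scalerBr scalerDr; abel.
- by rewrite lphi !rF lact scalerBr scalerDr; abel.
- by rewrite aF (linear_zero lact) (alternating_skew _ _ altF) subr0.
Qed.

Lemma multilinear_coboundary Pi p (F : pre p) :
  multilinear Pi -> multilinear F -> multilinear (coboundary Pi F).
Proof.
move=> mPi; have [[lPi rPi aPi] _] := mPi.
have lcob q := coboundary_linear mPi (p := q).
elim: p F => [|p IHp] F mF.
  by rewrite coboundary0E; apply: multilinear_opp; apply: multilinear_act.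
have [[lF rF aF] mF'] := mF.
split=> [|X]; last first.
  rewrite contract_coboundary; apply: multilinear_sub; last exact/IHp/mF'.
  by apply: multilinear_act => //; apply: adj_linear.
(* Linear relations between contractions of [Pi] pass to the maps D, which are their second
   components. *)
have adjE (X Y Z : L * L) a :
    contract X Pi = a *: contract Y Pi + contract Z Pi ->
    adj Pi X = fun z => a *: adj Pi Y z + adj Pi Z z.
  move=> ePi; apply: funext => z.
  exact: (congr1 (fun G : pre 0 => G.2 no_args z) ePi).
split=> [y a x x' | x a y y' | x]; rewrite !contract_coboundary.
- rewrite (adjE _ _ _ _ (lPi y a x x')) lie_act_linear_l // lF lcob.
  by rewrite scalerBr; abel.
- rewrite (adjE _ _ _ _ (rPi x a y y')) lie_act_linear_l // rF lcob.
  by rewrite scalerBr; abel.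
- have -> : adj Pi (x, x) = fun z => 0.
    apply: funext => z.
    exact: (congr1 (fun G : pre 0 => G.2 no_args z) (aPi x)).
  have act0 : lie_act (fun=> 0 : L) F = 0.
    have := lie_act_add_l (fun=> 0) (fun=> 0) mF.
    rewrite (_ : (fun x : L => _) = fun=> 0) => [|]; last first.
      by apply: funext => z; rewrite addr0.
    by rewrite -[LHS]addr0 => /addrI.
  by rewrite act0 aF (linear_zero (lcob _)) subrr.
Qed.

End Algebra.

Arguments coboundary {K L} Pi {p} F : simpl never.

(** * Shuffles with a block of length at most one *)

Section Shuffles.

(** An increasing self-map of a finite ordinal is pointwise at least the identity; this applies to
    [s] and to its inverse. *)
Lemma perm_increasing_id n (s : 'S_n) :
  (forall a b : 'I_n, (a < b)%N -> (s a < s b)%N) -> s = 1%g.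
Proof.
move=> s_lt.
have leq_incr (u : 'S_n) : (forall a b : 'I_n, (a < b)%N -> (u a < u b)%N) ->
    forall a : 'I_n, (a <= u a)%N.
  move=> u_lt a; case: a => m; elim: m => [|m IHm] lt_m //=.
  have lt_m' := ltnW lt_m.
  apply: leq_ltn_trans (IHm lt_m') _.
  exact: (u_lt (Ordinal lt_m') (Ordinal lt_m) (ltnSn m)).
apply/permP => a; rewrite perm1; apply/val_inj/eqP.
rewrite eqn_leq leq_incr // andbT.
have := leq_incr s^-1%g _ (s a); rewrite permK; apply=> b c lt_bc.
rewrite ltnNge leq_eqVlt negb_or -leqNgt; apply/andP; split.
  by rewrite (inj_eq val_inj) (inj_eq perm_inj) -val_eqE gtn_eqF.
by rewrite leqNgt; apply/negP => /s_lt; rewrite !permKV ltnNge ltnW.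
Qed.

Lemma lift_permP n (i : 'I_n.+1) (s : 'S_n.+1) :
  exists s' : 'S_n, s = lift_perm i (s i) s'.
Proof.
(* The map induced by [s] from the complement of [i] to that of [s i], both renumbered in increasing
   order. *)
pose r j := odflt j (unlift (s i) (s (lift i j))).
have rK j : lift (s i) (r j) = s (lift i j).
  rewrite /r; have := neq_lift i j.
  by rewrite -(inj_eq (@perm_inj _ s)) => /unlift_some[? ? ->].
have r_inj : injective r.
  by move=> j k /(congr1 (lift (s i))); rewrite !rK => /perm_inj/lift_inj.
exists (perm r_inj); apply/permP => j.
case: (unliftP i j) => [k|] ->; last by rewrite lift_perm_id.
by rewrite lift_perm_lift permE rK.
Qed.

Lemma ltn_lift n (i : 'I_n.+1) (a b : 'I_n) :
  (lift i a < lift i b)%N = (a < b)%N.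
Proof. by rewrite /= ltnNge leq_bump2 -ltnNge. Qed.

(** A permutation increasing away from [i] is determined by the image of [i]. Shuffles with a block
    of length 1 are of this kind, [i] being the first or the last index. *)
Lemma sum_increasing_off (V : nmodType) n (i : 'I_n.+1) (P : pred 'S_n.+1)
    (G : 'S_n.+1 -> V) :
  (forall s : 'S_n.+1, reflect
     (forall a b : 'I_n, (a < b)%N -> (s (lift i a) < s (lift i b))%N) (P s)) ->
  \sum_(s | P s) G s = \sum_(j < n.+1) G (lift_perm i j 1%g).
Proof.
move=> PP; rewrite (reindex (fun j => lift_perm i j 1%g)); last first.
  exists (fun s : 'S_n.+1 => s i) => [j _|s]; first by rewrite lift_perm_id.
  move=> /PP s_lt; have [s' def_s] := lift_permP i s.
  rewrite [RHS]def_s (_ : s' = 1%g) //; apply: perm_increasing_id => a b /s_lt.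
  by rewrite def_s !lift_perm_lift ltn_lift.
apply: eq_bigl => j; apply/PP => a b; rewrite !lift_perm_lift !perm1.
by rewrite ltn_lift.
Qed.

(* [is_shuffle], with i + j replaced by n to avoid casts. *)
Definition shuffle_at i n (s : 'S_n) : bool :=
  [forall a : 'I_n, forall b : 'I_n,
     (a < b)%N && ((b < i)%N || (i <= a)%N) ==> (s a < s b)%N].

Lemma shuffle_atP i n (s : 'S_n) :
  reflect (forall a b : 'I_n, (a < b)%N -> (b < i)%N || (i <= a)%N ->
             (s a < s b)%N)
          (shuffle_at i s).
Proof.
apply: (iffP forallP) => [s_lt a b lt_ab i_ab|s_lt a].
  by have /forallP/(_ b)/implyP := s_lt a; apply; rewrite lt_ab.
by apply/forallP => b; apply/implyP => /andP[]; apply: s_lt.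
Qed.

Lemma sum_shuffle0 (V : nmodType) p (G : 'S_(0 + p) -> V) :
  \sum_(s : 'S_(0 + p) | is_shuffle s) G s = G 1%g.
Proof.
rewrite (big_pred1 1%g) // => s; apply/(shuffle_atP 0)/eqP => [s_lt|-> a b].
  by apply: perm_increasing_id => a b lt_ab; apply: s_lt.
by rewrite !perm1.
Qed.

Lemma sum_shuffle1l (V : nmodType) p (G : 'S_(1 + p) -> V) :
  \sum_(s : 'S_(1 + p) | is_shuffle s) G s =
  \sum_(j < p.+1) G (lift_perm ord0 j 1%g).
Proof.
apply: (sum_increasing_off (n := p) (P := @shuffle_at 1 p.+1)) => s.
apply: (iffP (shuffle_atP 1 s)) => [s_lt a b lt_ab|s_lt a b].
  by apply: s_lt; rewrite ?ltn_lift.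
case: (unliftP ord0 a) => [a'|] ->; last by case: (unliftP ord0 b) => [b'|] ->.
by case: (unliftP ord0 b) => [b'|] -> //; rewrite ltn_lift => /s_lt.
Qed.

(* The permutation of 'I_n, n = k + 1, moving the last index to j and
   preserving the order of the others. *)
Definition last_to k n (e : k.+1 = n) (j : 'I_k.+1) : 'S_n :=
  cast_perm e (lift_perm ord_max j 1%g).

Lemma sum_shuffle1r (V : nmodType) k (G : 'S_(k + 1) -> V) :
  \sum_(s : 'S_(k + 1) | is_shuffle s) G s =
  \sum_(j < k.+1) G (last_to (esym (addn1 k)) j).
Proof.
(* With k + 1 replaced by a variable, eliminating the equality removes the cast. *)
suff gen n (e : k.+1 = n) (H : 'S_n -> V) :
    \sum_(s : 'S_n | shuffle_at k s) H s = \sum_(j < k.+1) H (last_to e j).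
  exact: gen.
case: n / e H => H; under [RHS]eq_bigr do rewrite /last_to cast_perm_id.
apply: sum_increasing_off => s.
apply: (iffP (shuffle_atP k s)) => [s_lt a b lt_ab|s_lt a b].
  by apply: s_lt; rewrite ?ltn_lift // lift_max ltn_ord.
case: (unliftP ord_max a) => [a'|] ->; last by rewrite ltnNge leq_ord.
case: (unliftP ord_max b) => [b'|] ->; first by rewrite ltn_lift => /s_lt.
by rewrite lift_max /= ltnn (leqNgt k) ltn_ord.
Qed.

Lemma odd_last_to k n (e : k.+1 = n) j : odd_perm (last_to e j) = odd (k + j).
Proof.
case: n / e; rewrite /last_to cast_perm_id odd_lift_perm odd_perm1 addbF.
by rewrite oddD.
Qed.

Lemma val_last_to k n (e : k.+1 = n) j (i : 'I_n) :
  val (last_to e j i) = if (i < k)%N then bump j i else j.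
Proof.
case: n / e i => i; rewrite /last_to cast_perm_id.
case: (unliftP ord_max i) => [i'|] ->.
  by rewrite lift_perm_lift perm1 !lift_max ltn_ord.
by rewrite lift_perm_id /= ltnn.
Qed.

Lemma perm_nat_last_to k n (e : k.+1 = n) j i : (i < n)%N ->
  perm_nat (last_to e j) i = if (i < k)%N then bump j i else j.
Proof. by move=> lt_i; rewrite /perm_nat insubT /= val_last_to. Qed.

End Shuffles.

(** * The bracket with a cochain of degree 1 *)

Section Explicit.
Context {K : fieldType} {L : lmodType K}.
Local Notation pre := (@precochain K L).

(** * Closed formulas for the coboundary *)

Lemma contractE1 p X (F : pre p.+1) Y :
  (contract X F).1 Y = F.1 (args_cons X Y).
Proof. by []. Qed.
Lemma contractE2 p X (F : pre p.+1) Y z :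
  (contract X F).2 Y z = F.2 (args_cons X Y) z.
Proof. by []. Qed.

Lemma args_del_max p X (Y : @args K L p.+1) :
  args_del (args_cons X Y) ord_max = args_cons X (args_del Y ord_max).
Proof.
rewrite -args_delS (_ : lift ord0 ord_max = ord_max) //; exact: val_inj.
Qed.

Lemma args_cons_max p X (Y : @args K L p.+1) :
  args_cons X Y ord_max = Y ord_max.
Proof.
rewrite -(args_consS X Y) (_ : lift ord0 ord_max = ord_max) //.
exact: val_inj.
Qed.

(** Unrolled recursion: the term j appears after j contractions, each giving a factor -1, and its
    derivation reaches only the arguments after X_j. The final -f.Pi in degree 0 supplies the term j
    = p and the last summand. *)
Lemma coboundary_snd (Pi : pre 1) p (F : pre p) X z :
  (coboundary Pi F).2 X z =
    \sum_(j < p.+1) (-1) ^+ j *: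
      (adj Pi (X j) (F.2 (args_del X j) z)
       - F.2 (args_del X j) (adj Pi (X j) z)
       - derive_args j (adj Pi (X j)) (F.2^~ z) (args_del X j))
    + (-1) ^+ p *:
      derive_slot (F.2 (args_del X ord_max)) (fun Y => adj Pi Y z) (X ord_max).
Proof.
elim: p F X => [|p IHp] F X; rewrite -(args_consK X);
  move: (X ord0) (args_del X ord0) => x Y.
  rewrite coboundary0E !precochainE {1}/lie_act /= big_ord1 expr0 !scale1r.
  rewrite derive_args_cons0 !derive_args_nil !addr0.
  rewrite (_ : ord_max = ord0); last exact: val_inj.
  rewrite args_cons0 (args0_unique (args_del _ _) no_args).
  by rewrite (args0_unique Y no_args) /derive_slot /adj; abel.
rewrite -contractE2 contract_coboundary !precochainE IHp /=.
rewrite [in RHS]big_ord_recl /= expr0 scale1r args_cons0 args_del0 opprD addrA.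
rewrite args_del_max args_cons_max exprS mulN1r scaleNr; congr (_ + _ - _).
rewrite -sumrN; apply: eq_bigr => j _.
by rewrite args_consS args_delS derive_args_consS exprS mulN1r scaleNr.
Qed.

(** The same unrolling, but the final -f.Pi now involves only the binary part of [Pi], so the sum
    stops before p. *)
Lemma coboundary_fst (Pi : pre 1) p (F : pre p) X :
  (coboundary Pi F).1 X =
    \sum_(j < p) (-1) ^+ j *:
      (adj Pi (X (widen_ord (leqnSn p) j))
           (F.1 (args_del X (widen_ord (leqnSn p) j)))
       - derive_args j (adj Pi (X (widen_ord (leqnSn p) j))) F.1
           (args_del X (widen_ord (leqnSn p) j)))
    + (-1) ^+ p *:
      (derive_slot (F.2 (args_del X ord_max))
         (fun Y => Pi.1 (args_cons Y no_args)) (X ord_max)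
       - F.2 (args_del X ord_max) (Pi.1 (args_cons (X ord_max) no_args))).
Proof.
elim: p F X => [|p IHp] F X; rewrite -(args_consK X);
  move: (X ord0) (args_del X ord0) => x Y.
  rewrite coboundary0E !precochainE {1}/lie_act /= big_ord0 expr0 scale1r.
  rewrite derive_args_cons0 !derive_args_nil !addr0.
  rewrite (_ : ord_max = ord0); last exact: val_inj.
  rewrite args_cons0 (args0_unique (args_del _ _) no_args).
  by rewrite (args0_unique Y no_args) /derive_slot; abel.
rewrite -contractE1 contract_coboundary !precochainE IHp /=.
rewrite [in RHS]big_ord_recl /= expr0 scale1r.
rewrite (_ : widen_ord _ ord0 = ord0); last exact: val_inj.
rewrite args_cons0 args_del0 opprD addrA.
rewrite args_del_max args_cons_max exprS mulN1r scaleNr; congr (_ + _ - _).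
rewrite -sumrN; apply: eq_bigr => j _.
rewrite (_ : widen_ord _ (lift ord0 j) = lift ord0 (widen_ord (leqnSn p) j)).
  by rewrite args_consS args_delS derive_args_consS exprS mulN1r scaleNr.
exact: val_inj.
Qed.

(** * Circle products with a factor of degree 1 *)

Lemma nth_argE n (X : @args K L n) (i : 'I_n) : nth_arg X i = X i.
Proof. by rewrite /nth_arg valK. Qed.

Lemma nth_arg_recast m n (e : m = n) (X : @args K L n) i :
  nth_arg [ffun j => X (cast_ord e j)] i = nth_arg X i.
Proof.
case: n / e X => X; congr nth_arg; apply/ffunP => j.
by rewrite ffunE cast_ord_id.
Qed.

Lemma perm_nat1 n i : (i < n)%N -> perm_nat (1%g : 'S_n) i = i.
Proof. by move=> lt_i; rewrite /perm_nat insubT /= perm1. Qed.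

Lemma args1E (X : @args K L 1) : X = args_cons (X ord0) no_args.
Proof. by rewrite -[LHS]args_consK (args0_unique (args_del _ _) no_args). Qed.

(** A single slot forces k = 0, and the only (0, p)-shuffle is the identity; hence the modified pair
    is the last one. *)
Lemma insertions_into_unary p (H : @args K L 1 -> L) (Q : pre p)
    (X : @args K L p.+1) :
  insertions H Q (X : args (1 + p)) =
    derive_slot (Q.2 (args_del X ord_max))
      (fun Y => H (args_cons Y no_args)) (X ord_max).
Proof.
have inner : inner_args (k := ord0 : 'I_1) (X : args (1 + p)) 1%g =
             args_del X ord_max.
  apply/ffunP => i; rewrite !ffunE perm_nat1; last exact: ltn_ord.
  rewrite add0n -(lift_max i).
  exact: nth_argE.
rewrite /insertions !big_ord1 addrC; congr (_ + _);
  (apply: etrans (sum_shuffle0 _) _);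
  rewrite odd_perm1 mul1r expr0 scale1r inner addn0 (args1E (plug _ _ _));
  congr (H (args_cons _ _)); rewrite ffunE /=;
  by rewrite -[p in nth_arg _ p]/(val (ord_max : 'I_p.+1)) !nth_argE.
Qed.

(** A (k, 1)-shuffle selects j <= k: X_j goes into [Q], and the result acts on argument k of the
    list without X_j. The signs (-1)^k and (-1)^(k+j) give (-1)^j, and exchanging the sums over k
    and j yields a derivation starting at index j. *)
Lemma insertions_of_unary p (H : @args K L p -> L) (Q : pre 1)
    (X : @args K L p.+1) (e : (p + 1 = p.+1)%N) :
  insertions H Q [ffun i => X (cast_ord e i)] =
    \sum_(j < p.+1) (-1) ^+ j *: derive_args j (adj Q (X j)) H (args_del X j).
Proof.
pose X' : args (p + 1) := [ffun i => X (cast_ord e i)].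
have nthX' i : nth_arg X' i = nth_arg X i by apply: nth_arg_recast.
have insertion (k : 'I_p) (g : args 1 -> L * L) :
  \sum_(s : 'S_(k + 1) | is_shuffle s) ((-1) ^+ (k * 1) * (-1) ^+ s : K) *:
     H (plug X' s (g (inner_args X' s))) =
  \sum_(j < p.+1 | (j <= k)%N) (-1) ^+ j *:
     H (set_arg (args_del X j) k (g (args_cons (X j) no_args))).
  rewrite sum_shuffle1r.
  (* Indexing by [nat] through [inord] lets [big_ord_widen] turn the range j < k.+1 into a condition
     on j < p.+1. *)
  pose G (j : nat) : L := (-1) ^+ j *:
    H (set_arg (args_del X (inord j)) k (g (args_cons (X (inord j)) no_args))).
  transitivity (\sum_(j < p.+1 | (j < k.+1)%N) G j); last first.
    by apply: eq_bigr => j _; rewrite /G inord_val.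
  rewrite -big_ord_widen; last by rewrite ltnS ltnW.
  apply: eq_bigr => j _; have lt_jp : (j < p.+1)%N.
    exact: leq_trans (ltn_ord j) (leqW (ltn_ord k)).
  rewrite /G odd_last_to signr_odd muln1 exprD signrMK.
  have nth_j : nth_arg X j = X (inord j).
    by rewrite -[in LHS](inordK lt_jp) nth_argE.
  have -> : inner_args X' (last_to (esym (addn1 k)) j) =
            args_cons (X (inord j)) no_args.
    rewrite [LHS]args1E; congr (args_cons _ _); rewrite ffunE addn0 nthX'.
    by rewrite perm_nat_last_to ?addn1 // ltnn.
  (* Before slot k, removing X_j shifts indices exactly as [last_to] does; after it, j <= k < i and
     both sides read index i + 1. *)
  congr (_ *: H _); apply/ffunP => i; rewrite [LHS]ffunE [RHS]ffunE -val_eqE.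
  have nth_i : nth_arg X (bump j i) = args_del X (inord j) i.
    by rewrite ffunE -nth_argE /= inordK.
  case: (ltngtP i k) => // [lt_ik|lt_ki].
    by rewrite nthX' perm_nat_last_to ?lt_ik // addn1 ltnS ltnW.
  rewrite nthX' -nth_i /bump (leq_trans _ (ltnW lt_ki)) ?addn1 ?add1n //.
  by rewrite -ltnS ltn_ord.
rewrite /insertions -big_split /=.
rewrite (eq_bigr (fun k : 'I_p => \sum_(j < p.+1 | (j <= k)%N) (-1) ^+ j *:
   (H (set_arg (args_del X j) k
         (adj Q (X j) (args_del X j k).1, (args_del X j k).2))
  + H (set_arg (args_del X j) k
         ((args_del X j k).1, adj Q (X j) (args_del X j k).2))))) => [|k _].
  rewrite (exchange_big_dep xpredT) //=; apply: eq_bigr => j _.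
  by rewrite scaler_sumr.
rewrite (insertion k (fun Y =>
  ((nth_arg X' (1 + k)).1, Q.2 Y (nth_arg X' (1 + k)).2))).
rewrite (insertion k (fun Y =>
  (Q.2 Y (nth_arg X' (1 + k)).1, (nth_arg X' (1 + k)).2))).
rewrite -big_split /=; apply: eq_bigr => j le_jk.
have -> : nth_arg X' (1 + k) = args_del X j k.
  by rewrite nthX' ffunE -nth_argE /= /bump le_jk.
by rewrite addrC scalerDr.
Qed.

Lemma fixes_last_ord_max n (s : 'S_n.+1) :
  fixes_last s = (s ord_max == ord_max).
Proof.
apply/forallP/idP => [/(_ ord_max)/implyP->// | s_max a].
by apply/implyP => a_max; rewrite (_ : a = ord_max) //; apply/val_inj/eqP.
Qed.

(** The last index moves only when 0 is sent there; for p = 0 the two coincide and the permutation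
    is the identity. *)
Lemma fixes_last_lift0 p (j : 'I_p.+1) :
  fixes_last (lift_perm ord0 j 1%g : 'S_p.+1) = (p == 0)%N || (j < p)%N.
Proof.
rewrite fixes_last_ord_max; case: p j => [|p] j.
  by rewrite !ord1 eqxx.
rewrite (_ : ord_max = lift ord0 ord_max) ?lift_perm_lift ?perm1; last first.
  exact: val_inj.
rewrite -val_eqE /= /bump /= add1n ltnS.
by case: leqP => _; rewrite ?add1n ?eqxx // ltn_eqF.
Qed.

Lemma fixes_last_last_to k n (e : k.+1 = n) j :
  fixes_last (last_to e j) = (j == ord_max).
Proof.
case: n / e; rewrite /last_to cast_perm_id fixes_last_ord_max.
by rewrite lift_perm_id.
Qed.

Lemma args_del_lift_perm p (X : @args K L p.+1) (j : 'I_p.+1) :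
  [ffun i : 'I_p => X (lift_perm ord0 j 1%g (rshift 1 i))] = args_del X j.
Proof.
apply/ffunP => i; rewrite !ffunE (_ : rshift 1 i = lift ord0 i).
  by rewrite lift_perm_lift perm1.
exact: val_inj.
Qed.

Lemma args_of_last_to p (X : @args K L p.+1) (e : (p + 1 = p.+1)%N)
    (e' : (p.+1 = p + 1)%N) j :
  [ffun i : 'I_p =>
     [ffun k => X (cast_ord e k)] (last_to e' j (lshift 1 i))] = args_del X j.
Proof.
apply/ffunP => i; rewrite !ffunE; congr (fun_of_fin X _); apply: val_inj.
by rewrite /= val_last_to /= ltn_ord.
Qed.

Lemma arg_of_last_to p (X : @args K L p.+1) (e : (p + 1 = p.+1)%N)
    (e' : (p.+1 = p + 1)%N) j :
  [ffun i : 'I_1 =>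
     [ffun k => X (cast_ord e k)] (last_to e' j (rshift p i))] =
  args_cons (X j) no_args.
Proof.
rewrite [LHS]args1E !ffunE; congr (args_cons (fun_of_fin X _) _).
by apply: val_inj; rewrite /= val_last_to /= addn0 ltnn.
Qed.

Lemma circ_unary_snd (Pi : pre 1) p (F : pre p) (X : @args K L p.+1) z :
  (circ Pi F).2 (X : args (1 + p)) z =
    (-1) ^+ p *: \sum_(j < p.+1) (-1) ^+ j *:
      adj Pi (X j) (F.2 (args_del X j) z)
    + derive_slot (F.2 (args_del X ord_max)) (fun Y => adj Pi Y z) (X ord_max).
Proof.
rewrite /circ /= insertions_into_unary; congr (_ + _).
rewrite scaler_sumr; apply: etrans (sum_shuffle1l _) _.
apply: eq_bigr => j _; rewrite odd_lift_perm odd_perm1 addbF signr_odd mul1n.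
rewrite scalerA -(args_del_lift_perm X j) (args1E (finfun _)) ffunE.
rewrite (_ : lshift p ord0 = ord0); last exact: val_inj.
by rewrite lift_perm_id.
Qed.

(** The condition on the last index drops j = p, except for p = 0, where the surviving term is D(X)
    applied to a value of [F.1]; the two hypotheses make it vanish. *)
Lemma circ_unary_fst (Pi : pre 1) p (F : pre p) (X : @args K L p.+1) :
  (forall Y, adj Pi Y 0 = 0) -> (p = 0%N -> F.1 = 0) ->
  (circ Pi F).1 (X : args (1 + p)) =
    (-1) ^+ p *: \sum_(j < p) (-1) ^+ j *:
      adj Pi (X (widen_ord (leqnSn p) j))
        (F.1 (args_del X (widen_ord (leqnSn p) j)))
    + derive_slot (F.2 (args_del X ord_max))
        (fun Y => Pi.1 (args_cons Y no_args)) (X ord_max).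
Proof.
move=> adj0 F1_0; rewrite /circ /= insertions_into_unary; congr (_ + _).
rewrite big_mkcondr scaler_sumr; apply: etrans (sum_shuffle1l _) _.
have term (j : 'I_p.+1) :
    Pi.2 [ffun i : 'I_1 => X (lift_perm ord0 j 1%g (lshift p i))]
      (F.1 [ffun i : 'I_p => X (lift_perm ord0 j 1%g (rshift 1 i))]) =
    adj Pi (X j) (F.1 (args_del X j)).
  rewrite -(args_del_lift_perm X j) (args1E (finfun _)) ffunE.
  rewrite (_ : lshift p ord0 = ord0); last exact: val_inj.
  by rewrite lift_perm_id.
rewrite big_ord_recr /= fixes_last_lift0 ltnn orbF [X in _ + X](_ : _ = 0).
  rewrite addr0; apply: eq_bigr => j _.
  rewrite fixes_last_lift0 /= ltn_ord orbT odd_lift_perm odd_perm1 addbF.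
  by rewrite signr_odd mul1n scalerA; congr (_ *: _); apply: term.
case: eqP => // p0; apply/eqP; rewrite scaler_eq0 orbC; apply/orP; left.
by apply/eqP; apply: etrans (term _) _; rewrite (F1_0 p0) adj0.
Qed.

Lemma circ_of_unary_snd (Pi : pre 1) p (F : pre p) (X : @args K L p.+1) z :
  (recast (addnC p 1) (circ F Pi)).2 X z =
    \sum_(j < p.+1) (-1) ^+ j *:
      (F.2 (args_del X j) (adj Pi (X j) z)
       + derive_args j (adj Pi (X j)) (F.2^~ z) (args_del X j)).
Proof.
rewrite /circ /= insertions_of_unary.
under [RHS]eq_bigr do rewrite scalerDr.
rewrite big_split /=; congr (_ + _).
apply: etrans (sum_shuffle1r _) _; apply: eq_bigr => j _.
rewrite odd_last_to signr_odd muln1 exprD signrMK args_of_last_to.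
by rewrite arg_of_last_to.
Qed.

Lemma circ_of_unary_fst (Pi : pre 1) p (F : pre p) (X : @args K L p.+1) :
  (recast (addnC p 1) (circ F Pi)).1 X =
    (-1) ^+ p *: F.2 (args_del X ord_max) (Pi.1 (args_cons (X ord_max) no_args))
    + \sum_(j < p) (-1) ^+ j *:
        derive_args j (adj Pi (X (widen_ord (leqnSn p) j))) F.1
          (args_del X (widen_ord (leqnSn p) j)).
Proof.
rewrite /circ /= insertions_of_unary; congr (_ + _); last first.
  (* For j = p the derivation is an empty sum: no remaining argument has index at least p. *)
  rewrite big_ord_recr /= [X in _ + (_ *: X)](_ : _ = 0) ?scaler0 ?addr0 //.
  by apply: big1_seq => k; rewrite leqNgt ltn_ord.
rewrite big_mkcondr; apply: etrans (sum_shuffle1r _) _.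
under eq_bigr do rewrite fixes_last_last_to.
rewrite -big_mkcond big_pred1_eq.
rewrite odd_last_to signr_odd muln1 exprD signrMK.
by rewrite args_of_last_to arg_of_last_to.
Qed.

(** The closed formulas of both circle products are compared with that of E term by term, using that
    (-1)^p squares to 1. *)
Lemma lieY_bracket_unary (Pi : pre 1) p (F : pre p) :
  (forall Y, adj Pi Y 0 = 0) -> (p = 0%N -> F.1 = 0) ->
  lieY_bracket Pi F = (-1) ^+ p *: coboundary Pi F :> pre p.+1.
Proof.
move=> adj0 F1_0; rewrite /lieY_bracket mul1n.
apply: precochain_eq => [X|X z]; rewrite !precochainE.
  rewrite circ_unary_fst // circ_of_unary_fst coboundary_fst.
  under [in RHS]eq_bigr do rewrite scalerBr.
  rewrite sumrB /derive_slot !scalerDr !scalerN !scalerA.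
  rewrite -!expr2 !sqrr_sign !scale1r.
  abel.
rewrite circ_unary_snd circ_of_unary_snd coboundary_snd.
under [X in _ - _ *: X]eq_bigr do rewrite scalerDr.
under [in RHS]eq_bigr do rewrite !scalerBr.
rewrite !sumrB big_split /derive_slot !scalerDr !scalerN !scalerA.
rewrite -!expr2 !sqrr_sign !scale1r.
abel.
Qed.

End Explicit.

(** * The compatible complex *)

Section Complex.
Context {K : fieldType} {L : lmodType K}.
Local Notation pre := (@precochain K L).

(** * Slotwise and recursive multilinearity *)

Lemma wedge_multilinear_cons p (F : @args K L p.+1 -> L) :
  wedge_multilinear F <->
  (forall Y, alternating_bilinear (fun x y => F (args_cons (x, y) Y))) /\
  (forall X, wedge_multilinear (fun Y => F (args_cons X Y))).
Proof.
split=> [mF | [altF mF] X k].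
  split=> [Y | X Y k].
    have := mF (args_cons 0 Y) ord0.
    by under eq_fun do under eq_fun do rewrite set_arg_cons0.
  have := mF (args_cons X Y) (lift ord0 k).
  by under eq_fun do under eq_fun do rewrite set_arg_consS.
rewrite -(args_consK X); move: (X ord0) (args_del X ord0) => x Y.
case: (unliftP ord0 k) => [j|] ->.
  under eq_fun do under eq_fun do rewrite set_arg_consS.
  exact: mF.
under eq_fun do under eq_fun do rewrite set_arg_cons0.
exact: altF.
Qed.

Lemma multilinear_wedge p (F : pre p) :
  multilinear F <->
  [/\ wedge_multilinear F.1, forall z, wedge_multilinear (F.2^~ z)
    & forall X, linear (F.2 X)].
Proof.
elim: p F => [|p IHp] F.
  split=> [lF | [_ _ ]]; last by apply.
  by split=> [X []|z X []|X] //; rewrite (args0_unique X no_args).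
split=> [[[lF rF aF] mF] | [/wedge_multilinear_cons[alt1 m1] m2 lF]].
  split.
  - apply/wedge_multilinear_cons; split=> [Y|X]; last first.
      by have /IHp[] := mF X.
    split=> [y a x x'|x a y y'|x].
    + exact: (congr1 (fun G : pre p => G.1 Y) (lF y a x x')).
    + exact: (congr1 (fun G : pre p => G.1 Y) (rF x a y y')).
    + exact: (congr1 (fun G : pre p => G.1 Y) (aF x)).
  - move=> z; apply/wedge_multilinear_cons; split=> [Y|X]; last first.
      by have /IHp[_ /(_ z)] := mF X.
    split=> [y a x x'|x a y y'|x].
    + exact: (congr1 (fun G : pre p => G.2 Y z) (lF y a x x')).
    + exact: (congr1 (fun G : pre p => G.2 Y z) (rF x a y y')).
    + exact: (congr1 (fun G : pre p => G.2 Y z) (aF x)).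
  - move=> X; rewrite -(args_consK X).
    by have /IHp[_ _ /(_ (args_del X ord0))] := mF (X ord0).
have alt2 z Y := proj1 (proj1 (wedge_multilinear_cons _) (m2 z)) Y.
split=> [|X]; last first.
  apply/IHp; split=> [|z|Y]; [exact: m1 | | exact: lF].
  by have /wedge_multilinear_cons[_ /(_ X)] := m2 z.
split=> [y a x x'|x a y y'|x]; apply: precochain_eq => [Y|Y z].
- by have [h _ _] := alt1 Y; apply: h.
- by have [h _ _] := alt2 z Y; apply: h.
- by have [_ h _] := alt1 Y; apply: h.
- by have [_ h _] := alt2 z Y; apply: h.
- by have [_ _ h] := alt1 Y; apply: h.
- by have [_ _ h] := alt2 z Y; apply: h.
Qed.

Lemma cochain_multilinear p (F : pre p) : cochain F -> multilinear F.
Proof. by case=> _ m1 m2 lF; apply/multilinear_wedge. Qed.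

Lemma multilinear_cochain p (F : pre p) :
  (p = 0%N -> F.1 = 0) -> multilinear F -> cochain F.
Proof. by move=> F1 /multilinear_wedge[]. Qed.

(** * Structure cochains, the axioms and anticommutation *)

Section StructureCochain.
Context (b : L -> L -> L) (t : L -> L -> L -> L).

Lemma adj_structure X : adj (structure_cochain b t) X = t X.1 X.2.
Proof. by apply: funext => z; rewrite /adj /= args_cons0. Qed.

Lemma lie_act_structure_fst phi X :
  (lie_act phi (structure_cochain b t)).1 (args_cons X no_args) =
    phi (b X.1 X.2) - (b (phi X.1) X.2 + b X.1 (phi X.2)).
Proof.
by rewrite /= derive_args_cons0 derive_args_nil /= !args_cons0 addr0.
Qed.

Lemma lie_act_structure_snd phi X z :
  (lie_act phi (structure_cochain b t)).2 (args_cons X no_args) z =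
    phi (t X.1 X.2 z) - t X.1 X.2 (phi z)
    - (t (phi X.1) X.2 z + t X.1 (phi X.2) z).
Proof.
by rewrite /= derive_args_cons0 derive_args_nil /= !args_cons0 addr0.
Qed.

Hypothesis ly : is_lie_yamaguti b t.

Lemma multilinear_structure : multilinear (structure_cochain b t).
Proof.
have [lb rb ab] := ly_binary ly.
split=> [|X a x y]; last by rewrite /= (ly_ternary_linear ly).
by split=> [y a x x'|x a y y'|x]; apply: precochain_eq => [Y|Y z];
   rewrite ?precochainE /= ?args_cons0 /=;
   rewrite ?lb ?rb ?ab //; have [lt rt at_] := ly_ternary_alternating ly z;
   rewrite ?lt ?rt ?at_.
Qed.

(** The first component is (LY3), the second (LY4). *)
Lemma lie_act_adj_structure X :
  lie_act (adj (structure_cochain b t) X) (structure_cochain b t) = 0.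
Proof.
apply: precochain_eq => [Y|Y z]; rewrite (args1E Y).
  rewrite lie_act_structure_fst adj_structure (ly_axiom3 ly).
  by rewrite subrr.
rewrite lie_act_structure_snd adj_structure (ly_axiom4 ly).
rewrite [RHS](_ : _ = 0) //; abel.
Qed.

End StructureCochain.

(** Polarisation: [Pi1 + Pi2] satisfies the same condition, so (E_1 + E_2)(E_1 + E_2) = 0, and both
    squares drop out of the expansion. *)
Lemma coboundary_anticommute (Pi1 Pi2 : pre 1) p (F : pre p) :
  multilinear Pi1 -> multilinear Pi2 ->
  (forall X, lie_act (adj Pi1 X) Pi1 = 0) ->
  (forall X, lie_act (adj Pi2 X) Pi2 = 0) ->
  (forall X, lie_act (adj Pi1 X) Pi2 + lie_act (adj Pi2 X) Pi1 = 0) ->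
  multilinear F ->
  coboundary Pi1 (coboundary Pi2 F) + coboundary Pi2 (coboundary Pi1 F) = 0.
Proof.
move=> m1 m2 mc1 mc2 mc12 mF.
have m12 := multilinear_add m1 m2.
have mc X : lie_act (adj (Pi1 + Pi2) X) (Pi1 + Pi2) = 0.
  rewrite (linear_add (lie_act_linear (adj_linear m12 X))).
  rewrite [adj _ X](_ : _ = fun z => adj Pi1 X z + adj Pi2 X z) //.
  by rewrite !lie_act_add_l // mc1 mc2 add0r addr0 addrC.
have := coboundary_square m12 mc mF.
have [mE1 mE2] := (multilinear_coboundary m1 mF, multilinear_coboundary m2 mF).
rewrite !coboundary_add_l //; last exact: multilinear_add.
rewrite (linear_add (coboundary_linear m1 (p := p.+1))).
rewrite (linear_add (coboundary_linear m2 (p := p.+1))).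
by rewrite !coboundary_square // add0r addr0.
Qed.

(** The first component is (CY4), the second (CY3). *)
Lemma compatible_structures b1 t1 b2 t2 X :
  @is_compatible_lie_yamaguti K L b1 t1 b2 t2 ->
  lie_act (adj (structure_cochain b1 t1) X) (structure_cochain b2 t2)
  + lie_act (adj (structure_cochain b2 t2) X) (structure_cochain b1 t1) = 0.
Proof.
move=> cly; apply: precochain_eq => [Y|Y z]; rewrite (args1E Y) precochainE.
  rewrite !lie_act_structure_fst !adj_structure.
  have := cly_axiom4 cly X.1 X.2 (Y ord0).1 (Y ord0).2.
  move=> /eqP; rewrite -subr_eq0 => /eqP cy4.
  by rewrite [RHS](_ : _ = 0) // -[RHS]cy4; abel.
rewrite !lie_act_structure_snd !adj_structure.
have := cly_axiom3 cly X.1 X.2 (Y ord0).1 (Y ord0).2 z.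
move=> /eqP; rewrite -subr_eq0 => /eqP cy3.
by rewrite [RHS](_ : _ = 0) // -[RHS]cy3; abel.
Qed.

(** * The operator on tuples *)

Lemma cochain0 p : cochain (0 : pre p).
Proof.
have alt0 : alternating_bilinear (fun _ _ => 0 : L).
  by split=> [y a x x'|x a y y'|] //; rewrite scaler0 addr0.
by split=> [|X k|z X k|X a x y] //; rewrite /= scaler0 addr0.
Qed.

Lemma cochainP p a (F G : pre p) :
  cochain F -> cochain G -> cochain (a *: F + G).
Proof.
move=> cF cG; have [[F1 _ _ _] [G1 _ _ _]] := (cF, cG).
apply: multilinear_cochain => [p0 /=|].
  by rewrite F1 ?G1 // scaler0 addr0.
by apply: multilinearP; apply: cochain_multilinear.
Qed.

(** [delta_c] up to sign, with a zero for the missing contribution at either end, so that all places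
    obey one formula. [inord i] is out of range only at [ord_max], where it is masked. *)
Definition total_coboundary (Pi1 Pi2 : pre 1) m
    (F : @compat_precochain K L m) : @compat_precochain K L m.+1 :=
  [ffun i : 'I_m.+2 =>
     (if i == ord0 then 0 else coboundary Pi2 (F (inord i.-1)))
     + (if i == ord_max then 0 else coboundary Pi1 (F (inord i)))].

Lemma total_coboundary_linear (Pi1 Pi2 : pre 1) m :
  multilinear Pi1 -> multilinear Pi2 ->
  linear (@total_coboundary Pi1 Pi2 m).
Proof.
move=> m1 m2 a F G; apply/ffunP => i; rewrite !ffunE !coboundary_linear //.
by do 2!case: ifP => _; rewrite scalerDr ?scaler0 ?add0r ?addr0 // addrACA.
Qed.

(** Place i collects E_2 E_2 F_(i-2), (E_2 E_1 + E_1 E_2) F_(i-1) and E_1 E_1 F_i, as far as these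
    entries exist; each vanishes. *)
Lemma total_coboundary_square (Pi1 Pi2 : pre 1) m
    (F : @compat_precochain K L m) :
  multilinear Pi1 -> multilinear Pi2 ->
  (forall X, lie_act (adj Pi1 X) Pi1 = 0) ->
  (forall X, lie_act (adj Pi2 X) Pi2 = 0) ->
  (forall X, lie_act (adj Pi1 X) Pi2 + lie_act (adj Pi2 X) Pi1 = 0) ->
  (forall i, multilinear (F i)) ->
  total_coboundary Pi1 Pi2 (total_coboundary Pi1 Pi2 F) = 0.
Proof.
move=> m1 m2 mc1 mc2 mc12 mF.
have cob0 Pi p : multilinear Pi -> coboundary Pi (0 : pre p) = 0.
  by move=> mPi; exact: (linear_zero (coboundary_linear mPi (p := p))).
have cobD Pi p : multilinear Pi -> {morph coboundary Pi (p := p) : G H / G + H}.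
  by move=> mPi; exact: (linear_add (coboundary_linear mPi (p := p))).
have anticomm i := coboundary_anticommute m1 m2 mc1 mc2 mc12 (mF i).
apply/ffunP => i; rewrite !ffunE -!val_eqE /=.
have [->|i_neq0] := eqVneq (nat_of_ord i) 0%N.
  rewrite /= inordK // add0r. rewrite cobD //= cob0 // add0r.
  by rewrite coboundary_square.
have [-> /=|i_neq_max] := eqVneq (nat_of_ord i) m.+2.
  rewrite inordK // eqxx addr0 addr0 /= coboundary_square //.
have lt_i : (i < m.+2)%N by rewrite ltn_neqAle i_neq_max -ltnS ltn_ord.
have gt_i : (0 < i)%N by rewrite lt0n.
have lt_pred_i : (i.-1 < m.+2)%N by apply: leq_ltn_trans lt_i; apply: leq_pred.
rewrite !inordK // !cobD // (negPf i_neq0).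
have -> : (i.-1 == m.+1) = false.
  by rewrite -eqSS prednK // (negPf i_neq_max).
(* At an interior place both mixed terms are present, while a pure term may be masked by a zero;
   both cases are treated at once. *)
have square0 Pi (c : bool) p (G : pre p) : multilinear Pi ->
    (forall X, lie_act (adj Pi X) Pi = 0) -> multilinear G ->
    coboundary Pi (if c then 0 else coboundary Pi G) = 0.
  by move=> mPi mcPi mG; case: c; [apply: cob0 | apply: coboundary_square].
by rewrite !square0 // add0r addr0 addrC.
Qed.

End Complex.

Theorem theorem4p6 (K : fieldType) (charK : [pchar K] =i pred0)
    (L : lmodType K)
    (b1 : L -> L -> L) (t1 : L -> L -> L -> L)
    (b2 : L -> L -> L) (t2 : L -> L -> L -> L) :
  is_compatible_lie_yamaguti b1 t1 b2 t2 ->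
  is_cochain_complex (@compat_cochain K L) (@delta_c K L b1 t1 b2 t2).
Proof.
move=> cly; have [ly1 ly2] := (cly_left cly, cly_right cly).
set Pi1 := structure_cochain b1 t1; set Pi2 := structure_cochain b2 t2.
have m1 : multilinear Pi1 by apply: multilinear_structure.
have m2 : multilinear Pi2 by apply: multilinear_structure.
have partialE (b : L -> L -> L) t p (F : precochain p) :
    is_lie_yamaguti b t -> cochain F ->
    partial b t F = (-1) ^+ p *: coboundary (structure_cochain b t) F.
  move=> ly [F1 _ _ _]; apply: lieY_bracket_unary => // Y.
  exact/linear_zero/adj_linear/multilinear_structure.
(* All entries of a tuple have the same degree m, so one global sign relates the two operators. *)
have deltaE m (F : compat_precochain m) : compat_cochain F ->
    delta_c b1 t1 b2 t2 F = (-1) ^+ m *: total_coboundary Pi1 Pi2 F.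
  move=> cF; apply/ffunP => i; rewrite !ffunE.
  case: eqP => [->|_]; first rewrite add0r partialE //.
    by rewrite (_ : inord _ = ord0) //; apply: val_inj; rewrite /= inordK.
  case: eqP => [->|_]; last by rewrite !partialE // scalerDr.
  rewrite addr0 partialE // (_ : inord _ = ord_max) //.
  by apply: val_inj; rewrite /= inordK.
have deltaC m (F : compat_precochain m) : compat_cochain F ->
    compat_cochain (delta_c b1 t1 b2 t2 F).
  (* The target degree is positive, so the condition on the first component is vacuous. *)
  move=> cF i; rewrite deltaE // ffunE; apply: multilinear_cochain => //.
  have mF j := cochain_multilinear (cF j).
  have mcob (b : L -> L -> L) t j : is_lie_yamaguti b t ->
      multilinear (coboundary (structure_cochain b t) (F j)).
    move=> ly; apply/multilinear_coboundary => //.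
    exact: multilinear_structure.
  rewrite -[_ *: _]addr0 ffunE; apply: multilinearP; last first.
    exact: cochain_multilinear (cochain0 _).
  by apply: multilinear_add; (case: ifP => _;
    [exact: cochain_multilinear (cochain0 _) | exact: mcob]).
have linC m (a : K) (F G : compat_precochain m) :
    compat_cochain F -> compat_cochain G -> compat_cochain (a *: F + G).
  move=> cF cG i; rewrite !ffunE; exact: cochainP.
move=> m; split.
- by split=> [i|a F G]; [rewrite ffunE; apply: cochain0 | apply: linC].
- exact: deltaC.
- move=> a F G cF cG; rewrite !deltaE //; last exact: linC.
  by rewrite total_coboundary_linear // scalerDr !scalerA mulrC.
move=> F cF; rewrite deltaE; last exact: deltaC.
rewrite deltaE // (linear_scale (total_coboundary_linear m1 m2 (m := m.+1))).
rewrite total_coboundary_square ?scaler0 // => X.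
- exact: lie_act_adj_structure.
- exact: lie_act_adj_structure.
- exact: compatible_structures.
- exact: cochain_multilinear.
Qed.
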